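(* Let $T$ be a tree that does not contain a subgraph isomorphic to $T_{3,3}$. Then $\mathrm{lcapt}(T) \leq \ell(T)$, where $\ell(T)$ is the number of leaves of $T$.
   Context: $T_{3,3}$ is the rooted tree of depth 2 whose root has exactly three children, each of which has exactly two children (leaves); it has 10 vertices. The localization game on a connected graph $G$ with $k$ cops: the robber first chooses a starting vertex (invisible to the cops; the robber knows the cops' strategy). Then rounds are played; in each round the cops choose (probe) any $k$ vertices $c_1,\dots,c_k$ of $G$ and learn $(d(c_1,r),\dots,d(c_k,r))$, where $r$ is the robber's current vertex; then the robber moves to a neighbor or stays put. The cops win if after finitely many rounds they can determine the robber's exact position. The localization number $\zeta(G)$ is the minimum $k$ for which the cops have a winning strategy. For $k \geq \zeta(G)$, $\mathrm{lcapt}_k(G)$ is the number of rounds (probes) needed for $k$ cops to determine the robber's location under optimal play (cops minimizing, robber maximizing), and $\mathrm{lcapt}(G) = \mathrm{lcapt}_{\zeta(G)}(G)$. (A tree not containing $T_{3,3}$ has $\zeta(T)=1$.) *)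

(* Defs.v *)
From mathcomp Require Import all_boot.
From mathcomp Require Import boolp.

Set Implicit Arguments.
Unset Strict Implicit.
Unset Printing Implicit Defensive.

(* Least natural number satisfying [P]; the value 0 taken when there is none
   is junk.  By [dist_spec], [localization_number_spec] and [lcaptk_spec]
   below, the minimum is attained for distances and for the localization number
   of a connected graph, and for the capture time of any winning number of
   cops. *)
Definition minimum (P : nat -> Prop) : nat :=
  match pselect (exists n, `[< P n >]) with
  | left exP => ex_minn exP
  | right _ => 0
  end.

Definition simple_graph (V : finType) (e : rel V) : Prop :=
  symmetric e /\ irreflexive e.

Definition connected_graph (V : finType) (e : rel V) : Prop :=
  0 < #|V| /\ forall x y : V, connect e x y.

Definition acyclic_graph (V : finType) (e : rel V) : Prop :=
  forall c : seq V, ucycle e c -> size c <= 2.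

Definition is_tree (V : finType) (e : rel V) : Prop :=
  [/\ simple_graph e, connected_graph e & acyclic_graph e].

Definition degree (V : finType) (e : rel V) (x : V) : nat :=
  #|[set y | e x y]|.

Definition num_leaves (V : finType) (e : rel V) : nat :=
  #|[set x | degree e x == 1]|.

Definition dist (V : finType) (e : rel V) (x y : V) : nat :=
  minimum (fun n => exists p : seq V, [/\ path e x p, last x p = y & size p = n]).

Definition has_subgraph (V W : finType) (e : rel V) (f : rel W) : Prop :=
  exists phi : W -> V, injective phi /\ forall u v, f u v -> e (phi u) (phi v).

(* [None] is the root, [Some (i, None)] its i-th child, and [Some (i, Some j)]
   the j-th child of the latter. *)
Definition T33_vertex : finType := option ('I_3 * option 'I_2).

Definition T33_child (u v : T33_vertex) : bool :=
  match u, v with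
  | None, Some (_, None) => true
  | Some (i, None), Some (j, Some _) => i == j
  | _, _ => false
  end.

Definition T33 : rel T33_vertex := fun u v => T33_child u v || T33_child v u.

(* The probe of a round is a function of the answers to the earlier probes,
   listed from the oldest to the most recent. *)
Definition cop_strategy (V : finType) (k : nat) : Type :=
  seq (k.-tuple nat) -> k.-tuple V.

(* [r i] is the robber's vertex when the probe number [i] (counted from 0) is
   made. *)
Definition robber_play (V : finType) (e : rel V) (r : nat -> V) : Prop :=
  forall i, r i.+1 = r i \/ e (r i) (r i.+1).

Fixpoint answers (V : finType) (e : rel V) (k : nat) (s : cop_strategy V k)
    (r : nat -> V) (n : nat) : seq (k.-tuple nat) :=
  match n with
  | 0 => [::]
  | n'.+1 => let h := answers e s r n' in
             rcons h [tuple of [seq dist e c (r n') | c <- s h]]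
  end.

(* The answers to the first [n] probes determine the robber's vertex.  That
   vertex is the one occupied during the last of these probes, [r n.-1],
   before the robber moves on.  For [n = 0] it is the starting vertex [r 0]:
   no probe is needed exactly when the graph has a single vertex. *)
Definition located (V : finType) (e : rel V) (k : nat) (s : cop_strategy V k)
    (r : nat -> V) (n : nat) : Prop :=
  forall r' : nat -> V, robber_play e r' ->
    answers e s r' n = answers e s r n -> r' n.-1 = r n.-1.

Definition winning_strategy (V : finType) (e : rel V) (k : nat)
    (s : cop_strategy V k) : Prop :=
  forall r, robber_play e r -> exists n, located e s r n.

Definition wins_within (V : finType) (e : rel V) (k : nat)
    (s : cop_strategy V k) (m : nat) : Prop :=
  forall r, robber_play e r -> exists2 n, n <= m & located e s r n.

(* At least one cop plays; the condition matters only for the graph with a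
   single vertex. *)
Definition localization_number (V : finType) (e : rel V) : nat :=
  minimum (fun k => 0 < k /\ exists s : cop_strategy V k, winning_strategy e s).

Definition lcaptk (V : finType) (e : rel V) (k : nat) : nat :=
  minimum (fun m => exists s : cop_strategy V k, wins_within e s m).

Definition lcapt (V : finType) (e : rel V) : nat :=
  lcaptk e (localization_number e).

Lemma minimum_spec (P : nat -> Prop) : (exists n, P n) ->
  P (minimum P) /\ forall n, P n -> minimum P <= n.
Proof.
move=> [n0 Pn0]; rewrite /minimum; case: pselect => [exP | []]; last first.
  by exists n0; apply/asboolP.
by case: ex_minnP => m /asboolP Pm mP; split=> // n Pn; apply/mP/asboolP.
Qed.

Lemma dist_spec (V : finType) (e : rel V) (x y : V) : connect e x y ->
  (exists p, [/\ path e x p, last x p = y & size p = dist e x y]) /\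
  forall p, path e x p -> last x p = y -> dist e x y <= size p.
Proof.
move=> /connectP[p ep yE].
have [|exd mind] := @minimum_spec
  (fun n => exists p, [/\ path e x p, last x p = y & size p = n]).
  by exists (size p), p.
by split=> // q eq yq; apply: mind; exists q.
Qed.

Lemma answers_ext (V : finType) (e : rel V) (k : nat) (s : cop_strategy V k)
    (r r' : nat -> V) (n : nat) :
  (forall i, i < n -> r i = r' i) -> answers e s r n = answers e s r' n.
Proof.
elim: n => //= n IHn rr'; rewrite IHn ?rr' // => i ltin.
by apply: rr'; rewrite ltnW.
Qed.

Lemma located_ext (V : finType) (e : rel V) (k : nat) (s : cop_strategy V k)
    (r r' : nat -> V) (n : nat) :
  (forall i, i <= n -> r i = r' i) -> located e s r n -> located e s r' n.
Proof.
move=> rr' loc q pq; rewrite -(@answers_ext _ e k s r r') => [/(loc q pq) ->|i /ltnW].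
  by apply: rr'; apply: leq_pred.
exact: rr'.
Qed.

(* König's lemma: a strategy that wins every play wins within a bounded number
   of rounds. *)
Lemma winning_strategy_bounded (V : finType) (e : rel V) (k : nat)
    (s : cop_strategy V k) :
  winning_strategy e s -> exists m, wins_within e s m.
Proof.
move=> win; apply: contrapT => nobound.
pose B (p : seq V) := forall m, exists r, [/\ robber_play e r,
  forall n, n <= m -> ~ located e s r n & forall i, i < size p -> r i = nth (r 0) p i].
have B0 : B [::].
  move=> m; apply: contrapT => nex; apply: nobound; exists m => r pr.
  apply: contrapT => nloc; apply: nex; exists r; split=> // n lenm loc.
  by apply: nloc; exists n.
have BS p : exists x, B p -> B (rcons p x).
  have [Bp|nBp] := pselect (B p); last first.
    by have [r _] := B0 0; exists (r 0).
  apply: contrapT => nex.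
  have /choice[f fP] : forall x, exists m, ~ exists r, [/\ robber_play e r,
      forall n, n <= m -> ~ located e s r n
    & forall i, i < size (rcons p x) -> r i = nth (r 0) (rcons p x) i].
    move=> x; apply: contrapT => nm; apply: nex; exists x => _ m.
    by apply: contrapT => nr; apply: nm; exists m.
  have [r [pr nloc rp]] := Bp (\max_x f x).
  apply: (fP (r (size p))); exists r; split=> // [n lenf|i].
    by apply: nloc; apply: leq_trans lenf (leq_bigmax _).
  rewrite size_rcons ltnS leq_eqVlt nth_rcons => /orP[/eqP->|ltip].
    by rewrite ltnn eqxx.
  by rewrite ltip; apply: rp.
have [g gP] := choice BS.
pose q n := iter n (fun p => rcons p (g p)) [::].
have sq n : size (q n) = n by elim: n => //= n IHn; rewrite size_rcons IHn.
have Bq n : B (q n) by elim: n => //= n IHn; apply: gP.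
have [r0 _] := B0 0.
pose r n := nth (r0 0) (q n.+1) n.
have qE x m n : m < n -> nth x (q n) m = r m.
  elim: n => // n IHn; rewrite ltnS leq_eqVlt => /orP[/eqP->|ltmn].
    by apply: set_nth_default; rewrite sq.
  by rewrite -IHn //= nth_rcons sq ltmn.
have agree n : exists r', [/\ robber_play e r', ~ located e s r' n
    & forall i, i <= n -> r' i = r i].
  have [r' [pr' nloc r'E]] := Bq n.+1 n.
  exists r'; split=> // [|i lein]; first exact: nloc.
  by rewrite r'E ?sq // qE.
have pr : robber_play e r.
  move=> i; have [r' [pr' _ r'E]] := agree i.+1.
  by rewrite -!r'E.
have [n locn] := win r pr.
have [r' [_ nloc r'E]] := agree n.
by apply: nloc; apply: located_ext locn => i /r'E.
Qed.

Lemma localization_number_spec (V : finType) (e : rel V) : connected_graph e ->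
  [/\ 0 < localization_number e,
      exists s : cop_strategy V (localization_number e), winning_strategy e s
    & forall k (s : cop_strategy V k), 0 < k -> winning_strategy e s ->
        localization_number e <= k].
Proof.
move=> [V_gt0 conn].
have [|[z_gt0 zwin] minz] := @minimum_spec
  (fun k => 0 < k /\ exists s : cop_strategy V k, winning_strategy e s).
  exists #|V|; split=> //; exists (fun=> enum_tuple V) => r pr.
  exists 1 => r' pr' /= [] /eq_in_map/(_ (r 0)).
  rewrite mem_enum => /(_ isT) d0.
  have [_ /(_ [::] isT erefl)] := dist_spec (conn (r 0) (r 0)).
  rewrite leqn0 -d0 => /eqP d'0.
  have [[p [_ lastp sizep]] _] := dist_spec (conn (r 0) (r' 0)).
  by move: sizep lastp; rewrite d'0 => /size0nil -> /=.
by split=> // k s k_gt0 win; apply: minz; split=> //; exists s.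
Qed.

Lemma lcaptk_spec (V : finType) (e : rel V) (k : nat) :
  (exists s : cop_strategy V k, winning_strategy e s) ->
  (exists s : cop_strategy V k, wins_within e s (lcaptk e k)) /\
  forall m (s : cop_strategy V k), wins_within e s m -> lcaptk e k <= m.
Proof.
move=> [s /winning_strategy_bounded[m win]].
have [|exs minm] := @minimum_spec
  (fun m => exists s : cop_strategy V k, wins_within e s m).
  by exists m, s.
by split=> // m' s' win'; apply: minm; exists s'.
Qed.

(* Main.v *)
(* One cop suffices.  Right after a probe, keep the knowledge "the robber is at
   distance [l] from [v] and not behind the neighbours already excluded".  Probing
   behind a neighbour [h] of degree at most 2 either finds the robber behind [h]
   or excludes [h], and he cannot cross [v] unnoticed.  A probe behind a neighbour
   [a] of degree at least 3 only confuses distance [l] outside [a] with distance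
   [l + 2] behind [a].  Without [T33], a vertex has at most two such neighbours;
   if the robber enters [v] from outside and both lie ahead, at most four probes
   exclude one of them, and this is paid for by its leaves.  By induction on the
   branch, a robber inside a branch with [P] leaves, at known distance from its
   root, is located by [P] probes, and by [P - 1] probes if [P <= 3].  A first probe
   at a leaf puts him in the branch containing all other leaves. *)

Require Import Defs.
From mathcomp Require Import all_boot boolp zify.

Set Implicit Arguments.
Unset Strict Implicit.
Unset Printing Implicit Defensive.

Section Tree.
Variables (V : finType) (e : rel V).
Hypothesis treeT : is_tree e.
Local Notation d := (dist e).

(** * Directions in a tree *)

Lemma edge_sym x y : e x y = e y x.
Proof. by case: treeT => -[sym _] _ _; apply: sym. Qed.

Lemma edge_irr x : e x x = false.
Proof. by case: treeT => -[_ irr] _ _; apply: irr. Qed.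

Lemma tree_conn x y : connect e x y.
Proof. by case: treeT => _ [_ conn] _; apply: conn. Qed.

Lemma dist_path x y : exists p, [/\ path e x p, last x p = y & size p = d x y].
Proof. by have [] := dist_spec (tree_conn x y). Qed.

Lemma dist_le x p : path e x p -> d x (last x p) <= size p.
Proof. by move=> ep; have [_ /(_ p ep erefl)] := dist_spec (tree_conn x (last x p)). Qed.

Lemma distxx x : d x x = 0.
Proof. by apply/eqP; rewrite -leqn0; apply: (@dist_le x [::]). Qed.

Lemma dist_eq0 x y : d x y = 0 -> x = y.
Proof. by have [p [_ <- <-]] := dist_path x y => /size0nil ->. Qed.

Lemma dist_tri y x z : d x z <= d x y + d y z.
Proof.
have [p [ep lp <-]] := dist_path x y; have [q [eq lq <-]] := dist_path y z.
rewrite -size_cat -lq -lp -last_cat; apply: dist_le.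
by rewrite cat_path ep lp.
Qed.

Lemma dist_sym x y : d x y = d y x.
Proof.
have le a b : d a b <= d b a.
  have [p [ep lp <-]] := dist_path b a.
  have erev : path e (last b p) (rev (belast b p)).
    rewrite rev_path; apply: sub_path ep => u v; by rewrite edge_sym.
  have := dist_le erev; rewrite size_rev size_belast lp.
  case: p {ep erev} lp => [|u p] /= lp; first by rewrite lp distxx.
  by rewrite rev_cons last_rcons.
by apply/eqP; rewrite eqn_leq !le.
Qed.

Lemma dist_edge x y : e x y -> d x y = 1.
Proof.
move=> exy; have := @dist_le x [:: y]; rewrite /= exy => /(_ isT).
case E: (d x y) => [|[|k]] // _; move/dist_eq0: E exy => ->.
by rewrite edge_irr.
Qed.

Lemma dist1_edge x y : d x y = 1 -> e x y.
Proof.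
have [[|z [|w p]] [/= ep lp <-]] := dist_path x y => // _.
by move: ep; rewrite -lp andbT.
Qed.

(** The tree without the edge [v u]; its two components yield the distance facts about [dir]. *)
Let cut v u : rel V :=
  fun x y => e x y && ~~ ((x == v) && (y == u) || (x == u) && (y == v)).

Let cut_sym v u : connect_sym (cut v u).
Proof.
apply: sym_connect_sym => x y; rewrite /cut edge_sym.
by rewrite orbC [(y == v) && _]andbC [(y == u) && _]andbC.
Qed.

(** A path from [v] to [u] avoiding the edge would close up with it to a cycle on at least three
    vertices. *)
Let cut_bridge v u : e v u -> ~~ connect (cut v u) v u.
Proof.
move=> evu; apply/negP => /connectP[p0 /shortenP[p cp up _] lp].
have ep : path e v p by apply: sub_path cp => x y /andP[].
have [_ _ /(_ (v :: p))] := treeT.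
rewrite /ucycle up /= rcons_path ep -lp edge_sym evu => /(_ isT).
case: p cp lp {ep up} => [|x [|y p]] //= cp lp _.
  by move: evu; rewrite lp edge_irr.
by move: cp; rewrite -lp /cut !eqxx /= andbF.
Qed.

Let cut_side v u r : e v u -> connect (cut v u) v r || connect (cut v u) u r.
Proof.
move=> evu; have /connectP[p ep ->] := tree_conn v r.
suff gen x : connect (cut v u) v x || connect (cut v u) u x ->
    path e x p -> connect (cut v u) v (last x p) || connect (cut v u) u (last x p).
  by apply: gen => //; rewrite connect0.
elim: p {ep} x => //= y p IHp x cx /andP[exy ep]; apply: IHp => //.
have [cxy|] := boolP (cut v u x y).
  by case/orP: cx => cx; rewrite (connect_trans cx (connect1 cxy)) ?orbT.
rewrite /cut exy negbK => /orP[] /andP[_ /eqP->]; by rewrite connect0 ?orbT.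
Qed.

(** Some step of the walk changes sides, and it can only be [v u]; the parts before and after it are
    at least as long as the distances. *)
Let cut_cross v u c p : e v u -> connect (cut v u) v c ->
  connect (cut v u) u (last c p) -> path e c p ->
  d c v + (d u (last c p)).+1 <= size p.
Proof.
move=> evu; elim: p c => [|y p IHp] c /= vc ur.
  have := cut_bridge evu; rewrite (connect_trans vc) //.
  by rewrite cut_sym.
case/andP=> ecy ep; have [ccy|] := boolP (cut v u c y).
  have := IHp y (connect_trans vc (connect1 ccy)) ur ep.
  by have := dist_tri y c v; rewrite (dist_edge ecy); lia.
rewrite /cut ecy negbK => /orP[] /andP[/eqP cE /eqP yE].
  by subst c y; rewrite distxx; have := dist_le ep; lia.
by move: vc; rewrite cE (negPf (cut_bridge evu)).
Qed.

Let cut_dist v u c r : e v u -> connect (cut v u) v c -> connect (cut v u) u r ->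
  d c r = d c v + (d u r).+1.
Proof.
move=> evu vc ur; have [p [ep lp sp]] := dist_path c r.
have := @cut_cross v u c p evu vc; rewrite lp => /(_ ur ep).
have := dist_tri v c r; have := dist_tri u v r; rewrite (dist_edge evu); lia.
Qed.

(** [r] lies behind the neighbour [u] of [v]: the path from [v] to [r] starts with the edge to [u].
    The form by distances makes answers to probes directly comparable. *)
Definition dir v u r := e v u && (d v r == (d u r).+1).

Let dir_cut v u r : e v u -> dir v u r = connect (cut v u) u r.
Proof.
move=> evu; rewrite /dir evu /=; apply/idP/idP => [/eqP dE|ur]; last first.
  by rewrite (cut_dist evu (connect0 _ _) ur) distxx.
have /orP[vr|//] := cut_side r evu.
have := cut_dist evu vr (connect0 _ _); rewrite distxx dist_sym.
by rewrite (dist_sym r v); lia.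
Qed.

Lemma dir_edge v u r : dir v u r -> e v u.
Proof. by case/andP. Qed.

Lemma dir_dist v u r : dir v u r -> d v r = (d u r).+1.
Proof. by case/andP => _ /eqP. Qed.

Lemma dirN_dist v u r : e v u -> ~~ dir v u r -> d u r = (d v r).+1.
Proof.
move=> evu; rewrite (dir_cut _ evu) => nur.
have := cut_side r evu; rewrite (negPf nur) orbF => vr.
have := cut_dist evu vr (connect0 _ _); rewrite distxx dist_sym.
by rewrite (dist_sym r v); lia.
Qed.

Lemma dir_flip v u r : e v u -> dir u v r = ~~ dir v u r.
Proof.
move=> evu; apply/idP/idP => [duv|ndvu].
  by apply/negP => dvu; have := dir_dist duv; have := dir_dist dvu; lia.
by rewrite /dir edge_sym evu (dirN_dist evu ndvu) /=.
Qed.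

(** The path from [c] to [r] has to cross the edge [v u], hence passes through [v]. *)
Lemma dir_sep v u c r : dir v u r -> ~~ dir v u c -> d c r = d c v + d v r.
Proof.
move=> dr; have evu := dir_edge dr; rewrite (dir_dist dr).
move: dr; rewrite !dir_cut // => ur nuc; apply: cut_dist => //.
by have := cut_side c evu; rewrite (negPf nuc) orbF.
Qed.

Lemma dir_self v u : dir v u v = false.
Proof. by rewrite /dir distxx andbF. Qed.

Lemma dir_nbr v u : e v u -> dir v u u.
Proof. by move=> evu; rewrite /dir evu distxx (dist_edge evu). Qed.

Lemma dir_uniq v u u' r : dir v u r -> dir v u' r -> u = u'.
Proof.
move=> du du'; have evu' := dir_edge du'.
have [duu'|ndu] := boolP (dir v u u').
  by apply: dist_eq0; have := dir_dist duu'; rewrite (dist_edge evu'); lia.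
have := dir_sep du ndu; rewrite (dir_dist du') (dist_sym u' v) (dist_edge evu'); lia.
Qed.

Lemma dir_ex v r : v <> r -> exists u, dir v u r.
Proof.
move=> vr; have [[|u p] [/= ep lp sp]] := dist_path v r; first by case: vr.
case/andP: ep => evu ep; exists u; rewrite /dir evu.
have := dist_le ep; rewrite lp; have := dist_tri u v r.
by rewrite (dist_edge evu); lia.
Qed.

Lemma dir_trans z v u r : e z v -> u != z -> dir v u r -> dir z v r.
Proof.
move=> ezv uz dr; rewrite -(negbK (dir z v r)) -dir_flip //.
by apply: contra uz => /(dir_uniq dr) ->.
Qed.

Lemma dir_split z v r : dir z v r -> r = v \/ exists2 u, u != z & dir v u r.
Proof.
move=> dr; have [->|/eqP vr] := eqVneq v r; first by left.
have [u du] := dir_ex vr; right; exists u => //.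
apply: contraTneq dr => uz; rewrite -uz in du *.
have evu := dir_edge du.
by rewrite (dir_flip _ evu) du.
Qed.

Definition step x y := y = x \/ e x y.

Lemma step_dist c x y : step x y -> d c y <= (d c x).+1 /\ d c x <= (d c y).+1.
Proof.
case=> [->|exy]; first by split; lia.
have := dist_tri x c y; have := dist_tri y c x.
by rewrite (dist_sym y x) (dist_edge exy); lia.
Qed.

(** Outside the branch, [y] is at distance [d y v + d v x] from [x]. One step bounds this by 1, and
    [d v x] is already positive. *)
Lemma step_dir v u x y : step x y -> dir v u x -> y = v \/ dir v u y.
Proof.
move=> sxy dx; have [|ndy] := boolP (dir v u y); first by right.
left; apply: dist_eq0; have := dir_sep dx ndy.
by have [] := step_dist y sxy; rewrite distxx (dir_dist dx); lia.
Qed.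

(** * Leaves of a branch *)

Definition nbrs v := [set u | e v u].
Definition leaf x := degree e x == 1.
Definition nleaves v u := #|[set x | leaf x && dir v u x]|.

Lemma nbr_le2 z v : e z v -> degree e v <= 2 ->
  (forall u, e v u -> u = z) \/
  exists w, [/\ e v w, w != z & forall u, e v u -> u = z \/ u = w].
Proof.
rewrite edge_sym => evz dv; have [N0|[w]] := set_0Vmem (nbrs v :\ z).
  left=> u evu; apply/eqP; apply: contraT => uz.
  by have := in_set0 u; rewrite -N0 !inE uz evu.
rewrite !inE => /andP[wz evw]; right; exists w; split=> // u evu.
move: dv; rewrite /degree -/(nbrs v) (cardsD1 z) (cardsD1 w) !inE evz evw wz.
rewrite !addnA /= => dv; have [|uz] := eqVneq u z; first by left.
right; apply/eqP; apply: contraT => uw; move: dv.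
by rewrite (cardsD1 u) !inE uw uz evu.
Qed.

Lemma nbr_le1 z v : e z v -> degree e v <= 1 -> forall u, e v u -> u = z.
Proof.
move=> ezv dv u evu; have [|[w [evw wz _]]] := nbr_le2 ezv (leqW dv); first by apply.
move: dv; rewrite leqNgt => /negP[]; apply/card_gt1P; exists w, z.
by rewrite !inE evw wz edge_sym.
Qed.

Lemma dir_leaf z v r : degree e v <= 1 -> dir z v r -> r = v.
Proof.
move=> dv dr; have [//|[u uz du]] := dir_split dr.
by move: uz; rewrite (nbr_le1 (dir_edge dr) dv (dir_edge du)) eqxx.
Qed.

Lemma dir_card z v u : e z v -> u != z -> e v u ->
  #|[set x | dir v u x]| < #|[set x | dir z v x]|.
Proof.
move=> ezv uz evu; apply: proper_card; apply/properP; split.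
  by apply/subsetP=> x; rewrite !inE; apply: dir_trans.
by exists v; rewrite !inE ?dir_self // dir_nbr.
Qed.

(** [v] is not a leaf, and any other vertex behind [v] lies behind exactly one neighbour of [v]
    besides [z]; the count is made leaf by leaf after exchanging the sums. *)
Lemma nleaves_split z v : e z v -> 1 < degree e v ->
  nleaves z v = \sum_(u in nbrs v :\ z) nleaves v u.
Proof.
move=> ezv dv; have nlv : ~~ leaf v by rewrite /leaf; case: (degree e v) dv => [|[]].
under eq_bigr do rewrite /nleaves cardsE -sum1_card big_mkcond /=.
rewrite exchange_big /nleaves cardsE -sum1_card big_mkcond /=.
apply: eq_bigr => x _; rewrite unfold_in /=.
have [lx|nlx] /= := boolP (leaf x); last by rewrite big1 // => u _; rewrite unfold_in (negPf nlx).
have /dir_ex[u0 du0] : v <> x by move=> vx; rewrite vx lx in nlv.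
rewrite (bigID (pred1 u0)) /= [X in _ = _ + X]big1 ?addn0; last first.
  move=> u /andP[_ /eqP uu0]; rewrite unfold_in /= lx /=.
  by case: ifP => // /(dir_uniq du0) /esym.
have [u0z|u0z] := eqVneq u0 z.
  rewrite big1 => [|u /andP[/setD1P[+ _] /eqP uu0]]; last by rewrite uu0 u0z eqxx.
  by rewrite (dir_flip _ (dir_edge (_ : dir v z x))) -u0z du0.
rewrite (dir_trans ezv u0z du0) (big_pred1 u0) ?unfold_in /= ?lx ?du0 //.
move=> u; rewrite /= !inE andbC; case: eqVneq => //= ->.
by rewrite u0z (dir_edge du0).
Qed.

Lemma nleaves_leaf z v : e z v -> degree e v <= 1 -> nleaves z v = 1.
Proof.
move=> ezv dv; rewrite /nleaves; apply/eqP/cards1P; exists v; apply/setP=> x.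
rewrite !inE; apply/andP/eqP => [[_ /(dir_leaf dv)]|->] //.
split; last by rewrite dir_nbr.
rewrite /leaf eqn_leq dv card_gt0; apply/set0Pn.
by exists z; rewrite inE edge_sym.
Qed.

Lemma nleaves_gt0 z v : e z v -> 0 < nleaves z v.
Proof.
have [n] := ubnP #|[set x | dir z v x]|; elim: n z v => // n IHn z v lt ezv.
have [dv|dv] := leqP (degree e v) 1; first by rewrite nleaves_leaf.
rewrite (nleaves_split ezv dv).
have zN : z \in nbrs v by rewrite inE edge_sym.
have [N0|[u uN]] := set_0Vmem (nbrs v :\ z).
  by move: dv; rewrite /degree -/(nbrs v) (cardsD1 z) zN N0 cards0.
rewrite (bigD1 u) //= ltn_addr //; move: uN; rewrite !inE => /andP[uz evu].
by apply: IHn => //; apply: leq_trans (dir_card ezv uz evu) _.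
Qed.

(* A branch with a single leaf [x] is a path ending at [x]. *)
Lemma path_branch z v : e z v -> nleaves z v = 1 -> exists x,
  [/\ dir z v x, forall r, dir z v r -> d x r + d z r = d x z
    & forall r r', dir z v r -> dir z v r' -> d z r = d z r' -> r = r'].
Proof.
have [n] := ubnP #|[set x | dir z v x]|; elim: n z v => // n IHn z v lt ezv.
have [dv _|dv] := leqP (degree e v) 1.
  exists v; split=> [|r /(dir_leaf dv) ->|r r' /(dir_leaf dv) -> /(dir_leaf dv) ->] //.
    exact: dir_nbr.
  by rewrite distxx dist_sym.
rewrite (nleaves_split ezv dv).
have zN : z \in nbrs v by rewrite inE edge_sym.
have [N0|[u uN]] := set_0Vmem (nbrs v :\ z).
  by move: dv; rewrite /degree -/(nbrs v) (cardsD1 z) zN N0 cards0.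
move: (uN); rewrite !inE => /andP[uz evu].
rewrite (bigD1 u) //=; have u0 := nleaves_gt0 evu => sum1.
have [|x [dx xP xinj]] := IHn v u (leq_trans (dir_card ezv uz evu) lt) evu; first by lia.
have only w : e v w -> w != z -> w = u.
  move=> evw wz; apply/eqP; apply: contraT => wu.
  move: sum1; rewrite (bigD1 w) /= ?inE ?wz ?wu ?evw //.
  by have := nleaves_gt0 evw; lia.
have dz r : dir z v r -> r = v \/ dir v u r.
  case/dir_split=> [|[w wz dw]]; [by left|right].
  by rewrite -(only w) // (dir_edge dw).
have dzr r : dir v u r -> d z r = (d v r).+1.
  by move=> dr; rewrite (dir_dist (dir_trans ezv uz dr)).
have dzv := dist_edge ezv.
have dxz : d x z = (d x v).+1 by rewrite dist_sym dzr // dist_sym.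
exists x; split=> [|r /dz[->|dr]|r r' /dz[->|dr] /dz[->|dr']] //.
- exact: dir_trans dx.
- by rewrite dxz dzv addn1.
- by rewrite dxz dzr // -(xP r dr) addnS.
- by rewrite dzv dzr // (dir_dist dr').
- by rewrite dzv dzr // (dir_dist dr).
by rewrite !dzr // => -[]; apply: xinj.
Qed.

Hypothesis noT33 : ~ has_subgraph e T33.

(** Otherwise [v], the three neighbours and two further neighbours of each form a copy of [T33]: the
    distance to [v] separates the levels, [dir] the branches. *)
Lemma branch_nbrs v a b c : e v a -> e v b -> e v c -> a != b -> a != c -> b != c ->
  2 < degree e a -> 2 < degree e b -> degree e c <= 2.
Proof.
move=> ea eb ec ab ac bc da db; rewrite leqNgt; apply/negP => dc.
pose n (i : 'I_3) := nth v [:: a; b; c] i.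
have en i : e v (n i) by case: i => -[|[|[]]].
have dn i : 2 < degree e (n i) by case: i => -[|[|[]]].
have ninj : injective n.
  move=> i j /eqP; rewrite /n nth_uniq //= ?inE ?negb_or ?ab ?ac ?bc //.
  by move/eqP/val_inj.
have chP i : exists f : 'I_2 -> V,
    injective f /\ forall j, dir v (n i) (f j) /\ d v (f j) = 2.
  have : 1 < #|nbrs (n i) :\ v|.
    have := dn i; rewrite /degree -/(nbrs (n i)) (cardsD1 v) inE edge_sym en.
    by lia.
  case/card_gt1P => x [y [xN yN xy]]; exists (fun j => nth v [:: x; y] j); split.
    move=> j j' /eqP; rewrite nth_uniq //= ?inE ?xy //.
    by move/eqP/val_inj.
  suff dw w : w \in nbrs (n i) :\ v -> dir v (n i) w /\ d v w = 2.
    by case=> -[|[|[]]] //= _; apply: dw.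
  rewrite !inE => /andP[wv enw]; have dw := dir_trans (en i) wv (dir_nbr enw).
  by rewrite (dir_dist dw) (dist_edge enw).
have [ch chP'] := choice chP; apply: noT33.
pose phi (w : T33_vertex) := match w with
  | None => v | Some (i, None) => n i | Some (i, Some j) => ch i j end.
have dphi w : d v (phi w) =
    match w with None => 0 | Some (_, None) => 1 | Some (_, Some _) => 2 end.
  case: w => [[i [j|]]|] /=; last exact: distxx.
    by have [_ /(_ j)[]] := chP' i.
  exact: dist_edge.
exists phi; split=> [w w' E|].
  have := congr1 (d v) E; rewrite !dphi.
  case: w w' E => [[i [j|]]|] [[i' [j'|]]|] //= E _; last by rewrite (ninj _ _ E).
  have [chi /(_ j)[di _]] := chP' i; have [_ /(_ j')[di' _]] := chP' i'.
  have ii : i = i' by apply: ninj; apply: dir_uniq di _; rewrite E.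
  by move: E; rewrite -ii => /chi ->.
have child w w' : T33_child w w' -> e (phi w) (phi w').
  case: w w' => [[i [j|]]|] [[i' [j'|]]|] //= /eqP ii.
  have [_ /(_ j')[di' dc2]] := chP' i'; rewrite ii; apply: dist1_edge.
  by have := dir_dist di'; rewrite dc2 => -[].
by move=> w w' /orP[/child|/child]; rewrite 1?edge_sym.
Qed.

(** * The game with one cop *)

Definition moved (S : V -> Prop) r := exists2 r0, S r0 & step r0 r.

(* [catch n S]: a robber known to be in [S] right after a probe is located by
   at most [n] further probes of a single cop. *)
Fixpoint catch (n : nat) (S : V -> Prop) : Prop :=
  (forall x y, S x -> S y -> x = y) \/
  match n with
  | 0 => False
  | n'.+1 => exists c, forall k, catch n' (fun r => moved S r /\ d c r = k)
  end.

Lemma catch_single n (S : V -> Prop) : (forall x y, S x -> S y -> x = y) -> catch n S.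
Proof. by case: n => [|n]; left. Qed.

Lemma catch_sub n (S S' : V -> Prop) : (forall x, S' x -> S x) -> catch n S -> catch n S'.
Proof.
elim: n S S' => [|n IHn] S S' sub /= [single|].
- by left=> x y /sub Sx /sub Sy; apply: single.
- by [].
- by left=> x y /sub Sx /sub Sy; apply: single.
case=> c cP; right; exists c => k; apply: IHn (cP k) => x [[x0 /sub Sx0 sx] dk].
by split=> //; exists x0.
Qed.

Lemma catch_leq m n S : m <= n -> catch m S -> catch n S.
Proof.
elim: n m S => [|n IHn] [|m] S //= lemn.
  by case=> // single; left.
case=> [single|[c cP]]; [by left|right; exists c => k].
exact: IHn (cP k).
Qed.

Lemma catch_probe c n (S : V -> Prop) :
  (forall y, moved S y -> catch n (fun r => moved S r /\ d c r = d c y)) ->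
  catch n.+1 S.
Proof.
move=> cP; right; exists c => k.
have [[y [Sy <-]]|no] := pselect (exists y, moved S y /\ d c y = k); first exact: cP.
by apply: catch_single => x y xP; case: no; exists x.
Qed.

(** The strategy replays the answers, carrying the number of probes left and the set of possible
    positions, and makes the probe that [catch] promises for this state. *)
Lemma catch_wins n : catch n (fun=> True) ->
  exists s : cop_strategy V 1, wins_within e s n.
Proof.
move=> Wn; have [V_gt0 _] : connected_graph e by case: treeT.
have /card_gt0P[v0 _] := V_gt0.
have fP (q : nat * (V -> Prop)) : exists c, catch q.1 q.2 ->
    ~ (forall x y, q.2 x -> q.2 y -> x = y) ->
    0 < q.1 /\ forall k, catch q.1.-1 (fun r => moved q.2 r /\ d c r = k).
  case: q => -[|m] S /=; first by exists v0 => -[].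
  have [[c cP]|no] := pselect
    (exists c, forall k, catch m (fun r => moved S r /\ d c r = k)).
    by exists c.
  by exists v0 => -[].
have [f {}fP] := choice fP.
pose upd (q : nat * (V -> Prop)) (a : 1.-tuple nat) :=
  (q.1.-1, fun r => moved q.2 r /\ d (f q) r = thead a).
pose st (h : seq (1.-tuple nat)) := foldl upd (n, fun=> True) h.
pose s : cop_strategy V 1 := fun h => [tuple f (st h)].
pose q r i := st (answers e s r i).
have qS r i : q r i.+1 = (
    (q r i).1.-1, fun x => moved (q r i).2 x /\ d (f (q r i)) x = d (f (q r i)) (r i)).
  by rewrite /q /= /st -cats1 foldl_cat.
(* After [i] probes the set concerns the vertex of the last one, hence [i.-1]. [catch] allows a move
   before every probe; before the first one the robber stays put. *)
have mem r : robber_play e r -> forall i, (q r i).2 (r i.-1).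
  move=> pr; elim=> [//|i IHi]; rewrite qS /=; split=> //; exists (r i.-1) => //.
  by case: i {IHi} => [|i] /=; [left | have [] := pr i; [left|right]].
have q1 r i : (q r i).1 = n - i.
  by elim: i => [|i IHi]; [rewrite subn0 | rewrite qS /= IHi subnS].
exists s => r pr.
suff gen m i : m + i = n -> catch (q r i).1 (q r i).2 ->
    exists2 j, j <= n & located e s r j.
  exact: (gen n 0 (addn0 n) Wn).
elim: m i => [|m IHm] i min Wi.
all: have [single|nsingle] := pselect (forall x y, (q r i).2 x -> (q r i).2 y -> x = y).
1,3: exists i; first lia; move=> r' pr' ans; apply: single; last exact: mem.
1,2: by rewrite /q -ans; apply: mem.
all: have [q0 next] := fP _ Wi nsingle.
  by move: q0; rewrite q1 -min subnn.
apply: (IHm i.+1); first by lia.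
by rewrite qS; apply: next.
Qed.

(** * Probes around a vertex *)

Definition sector v (R : {set V}) l r := d v r = l /\ forall u, dir v u r -> u \in R.
Definition branch v u l r := dir v u r /\ d v r = l.

Lemma sector0 v R r r' : sector v R 0 r -> sector v R 0 r' -> r = r'.
Proof. by move=> [/dist_eq0 <- _] [/dist_eq0 <- _]. Qed.

(** Off [v], the robber is inside a branch from [R] and one step takes him at most to [v], so he
    enters no excluded branch. *)
Lemma sector_moved v R l r : 0 < l -> moved (sector v R l) r ->
  sector v R (d v r) r /\ l.-1 <= d v r <= l.+1.
Proof.
move=> l_gt0 [r0 [dr0 r0R] st]; split; last first.
  by have := step_dist v st; rewrite dr0; lia.
split=> // u du; have /dir_ex[w dw] : v <> r0.
  by move=> vr0; move: l_gt0; rewrite -dr0 vr0 distxx.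
have [rv|dw'] := step_dir st dw; first by move: du; rewrite rv dir_self.
by rewrite (dir_uniq du dw') r0R.
Qed.

Lemma sectorD1 v R l u r : sector v R l r -> ~~ dir v u r -> sector v (R :\ u) l r.
Proof.
move=> [dr rR] ndu; split=> // w dw; rewrite !inE rR // andbT.
by apply: contraNneq ndu => <-.
Qed.

Lemma branch_moved v u r : moved (dir v u) r -> r = v \/ dir v u r.
Proof. by case=> r0 dr0 st; apply: step_dir st dr0. Qed.

Lemma catch_dir v u n : (forall l, catch n (branch v u l)) -> catch n.+1 (dir v u).
Proof.
move=> nP; apply: (@catch_probe v) => y _.
have [y0|y0] := eqVneq (d v y) 0.
  by apply: catch_single => r r' [_]; rewrite y0 => /dist_eq0 <- [_ /dist_eq0].
apply: catch_sub (nP (d v y)) => r [/branch_moved[->|//] dr].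
by move: y0; rewrite -dr distxx.
Qed.

Lemma catch_sector n v R l (S : V -> Prop) :
  (0 < l -> catch n (sector v R l)) ->
  (forall r, S r -> sector v R l r) -> catch n S.
Proof.
case: l => [|l] nP sub; last exact: catch_sub (nP (ltn0Sn l)).
by apply: catch_single => r r' /sub rP /sub; apply: sector0 rP.
Qed.

(** Probe the end [x] of the path behind [h]. An answer below [d x v] locates the robber on that
    path; any other excludes [h] and gives [d v r]. *)
Lemma path_probe n v R h l : e v h -> nleaves v h = 1 -> 0 < l ->
  (forall l', 0 < l' -> catch n (sector v (R :\ h) l')) ->
  catch n.+1 (sector v R l).
Proof.
move=> evh Ph l_gt0 nP; have [x [dx xP xinj]] := path_branch evh Ph.
have out r : ~~ dir v h r -> d x r = d v r + d x v.
  by move=> nd; rewrite dist_sym (dir_sep dx nd) (dist_sym r) (dist_sym v x).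
have inn r : dir v h r -> d x r < d x v.
  by move=> dr; have := xP r dr; have := dir_dist dr; lia.
apply: (@catch_probe x) => y yP; have [dy|ndy] := boolP (dir v h y).
  suff yE r : moved (sector v R l) r /\ d x r = d x y -> r = y.
    by apply: catch_single => r r' /yE-> /yE->.
  case=> _ dxr; have dr : dir v h r.
    by apply: contraT => /out; have := inn y dy; lia.
  by apply: xinj => //; have := xP _ dr; have := xP _ dy; lia.
apply: (@catch_sector _ v (R :\ h) (d v y)); first exact: nP.
move=> r [/(sector_moved l_gt0)[rP _] dxr].
have ndr : ~~ dir v h r.
  by apply/negP => /inn; have := out y ndy; lia.
have <- : d v r = d v y by have := out y ndy; have := out r ndr; lia.
exact: sectorD1.
Qed.

Lemma dist_behind v h w r : e v h -> e h w -> w != v ->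
  (forall u, e h u -> u = v \/ u = w) ->
  [\/ ~~ dir v h r /\ d w r = (d v r).+2, r = h | dir v h r /\ d v r = (d w r).+2].
Proof.
move=> evh ehw wv hN; have [dr|ndr] := boolP (dir v h r); last first.
  constructor 1; split=> //; have <- := dirN_dist evh ndr.
  by apply: dirN_dist => //; apply: contra ndr; apply: dir_trans.
have [->|[u uv du]] := dir_split dr; first by constructor 2.
constructor 3; split=> //; have [uE|uE] := hN u (dir_edge du).
  by rewrite uE eqxx in uv.
by rewrite (dir_dist dr); subst u; rewrite (dir_dist du).
Qed.

(* Probing behind [h] can only confuse [h] itself with the vertices at distance
   3 from [v], and only if the robber was at distance 2 from [v]. *)
Lemma nonbranch_probe n v R h l : e v h -> degree e h <= 2 -> 0 < l ->
  (forall l', 0 < l' <= l.+1 -> catch n (sector v (R :\ h) l')) ->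
  (forall l', l' <= l.+1 -> catch n (branch v h l')) ->
  (l = 2 -> catch n (dir v h)) ->
  catch n.+1 (sector v R l).
Proof.
move=> evh dh l_gt0 nP fP f2; have dvh := dist_edge evh.
have [hN|[w [ehw wv hN]]] := nbr_le2 evh dh.
  have dirh r : dir v h r -> r = h.
    by case/dir_split => // -[u uv /dir_edge/hN uE]; rewrite uE eqxx in uv.
  apply: (@catch_probe h) => y yP; have [/dirh->|ndy] := boolP (dir v h y).
    by apply: catch_single => r r' [_]; rewrite distxx => /dist_eq0<- [_ /dist_eq0].
  have [_ yl] := sector_moved l_gt0 yP.
  apply: (@catch_sector _ v (R :\ h) (d v y)) => [y0|r [/(sector_moved l_gt0)[rP _]]].
    by apply: nP; lia.
  rewrite (dirN_dist evh ndy) => dhr; have ndr : ~~ dir v h r.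
    by apply/negP => /dirh rh; move: dhr; rewrite rh distxx.
  have := dirN_dist evh ndr; rewrite dhr => -[->]; exact: sectorD1.
have dwh : d w h = 1 by rewrite dist_sym dist_edge.
have cases r := dist_behind r evh ehw wv hN.
(* After the move [d v r] is within 1 of [l], so answers are at least [l.+1] outside the branch and
   at most [l.-1] beyond [h]; only [h] itself, answering 1, can collide. *)
apply: (@catch_probe w) => y yP; have [_ yl] := sector_moved l_gt0 yP.
have [[ndy dwy]|yh|[dy dwy]] := cases y.
- apply: (@catch_sector _ v (R :\ h) (d v y)) => [y0|r [/(sector_moved l_gt0)[rP rl]]].
    by apply: nP; lia.
  rewrite dwy => dwr; have [[ndr dwr']|rh|[dr dwr']] := cases r.
  + by have <- : d v r = d v y by [lia]; apply: sectorD1.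
  + by subst r; lia.
  + by lia.
- subst y; have [l2|l2] := eqVneq l 2.
    apply: catch_sub (f2 l2) => r [/(sector_moved l_gt0)[rP rl] dwr].
    by have [[ndr dwr']|->|[]] := cases r; [lia|exact: dir_nbr|].
  apply: catch_single => r r'.
  suff hE x : moved (sector v R l) x /\ d w x = d w h -> x = h by move=> /hE-> /hE->.
  case=> /(sector_moved l_gt0)[_ xl] dwx.
  by have [[_ dwx']|//|[_ dwx']] := cases x; move/eqP: l2; lia.
have [l2|l2] := eqVneq l 2.
  apply: catch_sub (f2 l2) => r [/(sector_moved l_gt0)[rP rl] dwr].
  by have [[ndr dwr']|->|[]] := cases r; [lia|exact: dir_nbr|].
have yl1 : d v y <= l.+1 by lia.
apply: catch_sub (fP _ yl1) => r [/(sector_moved l_gt0)[_ rl] dwr].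
by have [[_ dwr']|rh|[dr dwr']] := cases r; [lia| |split=> //; lia];
  subst r; move/eqP: l2; lia.
Qed.

(* The branch of [u] is never probed; [dl] is the number of probes saved there. *)
Lemma star_catch v (R : {set V}) u dl l : {subset R <= nbrs v} -> u \in R ->
  dl <= 1 -> 0 < l ->
  (forall h, h \in R -> h != u -> degree e h <= 2) ->
  (forall h, h \in R -> h != u -> 1 < nleaves v h -> dl.+2 <= nleaves v u) ->
  (forall h, h \in R -> h != u -> forall l', catch (nleaves v h) (branch v h l')) ->
  (forall l', catch (nleaves v u - dl) (branch v u l')) ->
  catch (\sum_(h in R) nleaves v h - dl) (sector v R l).
Proof.
have [n] := ubnP #|R|; elim: n R l => // n IHn R l lt RN uR dl1 l_gt0 R2 Rdl Rc uc.
have evu : e v u by have := RN u uR; rewrite inE.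
have Pu := nleaves_gt0 evu.
have [R0|[h hR]] := set_0Vmem (R :\ u).
  have -> : R = [set u] by rewrite -(setD1K uR) R0 setU0.
  rewrite big_set1; apply: catch_sub (uc l) => r [dr rR].
  have /dir_ex[w dw] : v <> r by move=> vr; move: l_gt0; rewrite -dr vr distxx.
  by split=> //; have := rR w dw; rewrite inE => /eqP <-.
move: hR; rewrite !inE => /andP[hu hR]; have evh : e v h by have := RN h hR; rewrite inE.
have Ph := nleaves_gt0 evh.
rewrite (big_setD1 h) //=; set s := \sum_(_ in _) _.
have uR' : u \in R :\ h by rewrite !inE eq_sym hu.
have s_ge : nleaves v u <= s by rewrite /s (bigD1 u) //= leq_addr.
have IH l' : 0 < l' -> catch (s - dl) (sector v (R :\ h) l').
  have sub x : x \in R :\ h -> x \in R by case/setD1P.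
  move=> l'_gt0; apply: IHn => //.
  - by move: lt; rewrite (cardsD1 h) hR.
  - by move=> x /sub; apply: RN.
  - by move=> x /sub; apply: R2.
  - by move=> x /sub; apply: Rdl.
  - by move=> x /sub; apply: Rc.
have [P1|P1] := leqP (nleaves v h) 1.
  have -> : nleaves v h + s - dl = (s - dl).+1 by lia.
  by apply: path_probe IH => //; lia.
have Pu2 := Rdl h hR hu P1.
have -> : nleaves v h + s - dl = (nleaves v h + s - dl.+1).+1 by lia.
have fc l' : catch (nleaves v h + s - dl.+1) (branch v h l').
  by apply: catch_leq (Rc h hR hu l'); lia.
apply: (@nonbranch_probe _ v R h) => // [|l' /andP[l'_gt0 _]|_]; first exact: R2.
  by apply: catch_leq (IH l' l'_gt0); lia.
(* [catch_dir] needs one probe more than there are leaves behind [h]; [dl.+2 <= nleaves v u] makes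
   room for it. *)
have := @catch_dir v h (nleaves v h) (Rc h hR hu).
by apply: catch_leq; lia.
Qed.

Lemma setD1C (R : {set V}) a b : R :\ a :\ b = R :\ b :\ a.
Proof. by apply/setP=> x; rewrite !inE andbCA. Qed.

(** As [z] has at most one neighbour besides [v], its branch holds at most one vertex at each of the
    distances 1 and 2. *)
Lemma near_branch_single v z l r r' : degree e z <= 2 -> l <= 2 ->
  branch v z l r -> branch v z l r' -> r = r'.
Proof.
move=> dz l2 [dr dvr] [dr' dvr']; have evz := dir_edge dr.
have near x : dir v z x -> d v x = l ->
    x = z /\ d v x = 1 \/ [/\ e z x, x != v & d v x = 2].
  move=> dx dvx; have [->|[u uv du]] := dir_split dx; first by left; rewrite dist_edge.
  have := dir_dist dx; have := dir_dist du; case E: (d u x) => [|k]; last by lia.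
  by right; move/dist_eq0: E du uv => -> /dir_edge ezx xv; split=> //; lia.
have [[rz d1]|[er rv d2]] := near r dr dvr; have [[rz' d1']|[er' r'v d2']] := near r' dr' dvr'.
- by rewrite rz rz'.
- by lia.
- by lia.
have [zN|[w [_ _ zN]]] := nbr_le2 evz dz; first by rewrite (zN r er) (zN r' er').
have [rE|->] := zN r er; first by rewrite rE eqxx in rv.
by have [rE|->] := zN r' er'; first by rewrite rE eqxx in r'v.
Qed.

Lemma center_probe n v R (S : V -> Prop) :
  (forall r, S r -> exists2 l, 0 < l & sector v R l r) ->
  (forall l, 0 < l -> catch n (sector v R l)) -> catch n.+1 S.
Proof.
move=> SP nP; apply: (@catch_probe v) => y _.
apply: (@catch_sector _ v R (d v y)); first exact: nP.
move=> r [[r0 /SP[l l_gt0 r0P] st] <-].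
by have [|//] := @sector_moved v R l r l_gt0; first by exists r0.
Qed.

Lemma dirN_sector v (R : {set V}) u l r : u \notin R -> sector v R l r -> ~~ dir v u r.
Proof. by move=> uR [_ rR]; apply: contra uR; apply: rR. Qed.

(** * Vertices with two neighbours of degree at least 3 *)

Section TwoBranchNeighbours.
Variables (v z : V).
Hypotheses (evz : e v z) (dz : degree e z <= 2).
Let R := nbrs v :\ z.

(* The robber is at [v] or just behind [a], so he may slip into the cleared
   branch of [z]; probing [b] confines him to the neighbours of [v] other than
   [b], after which a probe behind [z] still finds him there. *)
Lemma slip_catch n a b : e v a -> e v b -> a != b ->
  (forall l, 0 < l <= 2 -> catch n (sector v (R :\ b) l)) ->
  (forall l, catch n.+1 (branch v a l)) -> catch n.+2 (fun r => d a r = 1).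
Proof.
move=> eva evb ab nP aP; apply: (@catch_probe b) => y _.
have dva := dist_edge eva; have dvb := dist_edge evb.
have ndab : ~~ dir v a b.
  by apply: contra ab => /dir_dist; rewrite dvb => -[/esym/dist_eq0 ->].
have cases r : moved (fun r => d a r = 1) r ->
    [\/ r = b, [/\ dir v a r, 0 < d v r & d b r = (d v r).+1]
      | [/\ ~~ dir v a r, ~~ dir v b r, d v r <= 1 & d b r = (d v r).+1]].
  case=> r0 d0 st; have [dr|ndr] := boolP (dir v a r).
    by constructor 2; rewrite (dir_sep dr ndab) (dist_sym b) dvb (dir_dist dr).
  have := step_dist a st; rewrite d0 (dirN_dist eva ndr) => -[le1 _].
  have [db|ndb] := boolP (dir v b r).
    constructor 1; have := dir_dist db; case E: (d b r) => [|k]; last by lia.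
    by move/dist_eq0: E.
  by constructor 3; rewrite (dirN_dist evb ndb).
(* Answers 0 and 1 mean [b] and [v], answer 2 a neighbour of [v] other than [b], and a larger one
   the branch of [a] at a known distance. *)
case E: (d b y) => [|[|[|k]]].
- by apply: catch_single => r r' [_ /dist_eq0 <-] [_ /dist_eq0].
- apply: catch_single => r r'.
  suff rE x : moved (fun r => d a r = 1) x /\ d b x = 1 -> x = v by move=> /rE-> /rE->.
  case=> /cases[->|[_ x0 ->]|[_ _ _ ->]] [].
  + by rewrite distxx.
  + by lia.
  + by move/dist_eq0.
- have: catch n.+1 (sector v (nbrs v :\ b) 1).
    apply: (@nonbranch_probe _ v _ z) => // [l l2|l l2].
      by rewrite setD1C; apply: nP.
    by apply: catch_single => r r'; apply: near_branch_single.
  apply: catch_sub => r [/cases[->|[dr r0 ->]|[ndr ndb _ ->]] []].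
  + by rewrite distxx.
  + move=> dr1; split=> // u du; rewrite !inE (dir_edge du) andbT.
    rewrite (dir_uniq du dr); exact: ab.
  move=> dr1; split=> // u du; rewrite !inE (dir_edge du) andbT.
  by apply: contraNneq ndb => <-.
apply: catch_sub (aP k.+2) => r [/cases[->|[dr r0 ->]|[ndr ndb le1 ->]] []].
- by rewrite distxx.
- by split.
by lia.
Qed.

(** Probe [a]. Answer 0 means [a], answer 1 is the situation of [slip_catch], and a larger one
    excludes [a], since the robber is within distance 2 of [v]. *)
Lemma adjacent_catch n a b : e v a -> e v b -> a != b ->
  (forall l, 0 < l -> catch n.+2 (sector v (R :\ a) l)) ->
  (forall l, 0 < l <= 2 -> catch n (sector v (R :\ b) l)) ->
  (forall l, catch n.+1 (branch v a l)) -> catch n.+3 (sector v R 1).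
Proof.
move=> eva evb ab oP nP aP; apply: (@catch_probe a) => y _.
case E: (d a y) => [|[|k]].
- by apply: catch_single => r r' [_ /dist_eq0 <-] [_ /dist_eq0].
- by apply: catch_sub (slip_catch eva evb ab nP aP) => r [].
apply: catch_sub (oP k.+1 isT) => r [/(sector_moved (ltn0Sn 0))[rP rl] dar].
have [dr|ndr] := boolP (dir v a r); first by have := dir_dist dr; lia.
have := dirN_dist eva ndr; rewrite dar => -[dvr].
by rewrite dvr; apply: sectorD1.
Qed.

(** Probe [a]: only the answer [l] is ambiguous, between distance [l.-1] outside [a] and [l.+1]
    behind it. Then probe [b]: its answer shows the branch of [b], excludes [b], or rules out
    [a]. *)
Lemma distant_catch n a b l : e v a -> e v b -> a != b -> 1 < l ->
  (forall l, 0 < l -> catch n (sector v (R :\ a) l)) ->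
  (forall l, 0 < l -> catch n.+2 (sector v (R :\ b) l)) ->
  (forall l, catch n.+3 (branch v a l)) ->
  (forall l, catch n.+1 (branch v b l)) -> catch n.+4 (sector v R l).
Proof.
move=> eva evb ab l2 naP nbP aP bP; have l_gt0 : 0 < l by lia.
apply: (@catch_probe a) => y _.
have dista r : dir v a r /\ d v r = (d a r).+1 \/ ~~ dir v a r /\ d a r = (d v r).+1.
  have [dr|ndr] := boolP (dir v a r); [left|right]; split=> //; first exact: dir_dist.
  exact: dirN_dist.
have distb r : dir v b r /\ d v r = (d b r).+1 \/ ~~ dir v b r /\ d b r = (d v r).+1.
  have [dr|ndr] := boolP (dir v b r); [left|right]; split=> //; first exact: dir_dist.
  exact: dirN_dist.
have [lt|lt|eq_l] := ltngtP (d a y) l.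
- apply: catch_sub (aP (d a y).+1) => r [/(sector_moved l_gt0)[rP rl] dar].
  by have [[dr dvr]|[ndr dar']] := dista r; [split=> //; lia | lia].
- have /naP/(@catch_leq _ n.+3) cP : 0 < (d a y).-1 by lia.
  apply: catch_sub (cP _) => [r [/(sector_moved l_gt0)[rP rl] dar]|]; last by lia.
  have [[dr dvr]|[ndr dar']] := dista r; first by lia.
  have <- : d v r = (d a y).-1 by lia.
  exact: sectorD1.
rewrite eq_l; set S1 := fun r => _ /\ _.
have S1P r : S1 r -> sector v R (d v r) r /\
    (~~ dir v a r /\ d v r = l.-1 \/ dir v a r /\ d v r = l.+1).
  case=> /(sector_moved l_gt0)[rP rl] dar; split=> //.
  by have [[dr dvr]|[ndr dar']] := dista r; [right|left]; split=> //; lia.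
have S1m r : moved S1 r -> sector v R (d v r) r /\
    (~~ dir v a r /\ l.-2 <= d v r <= l \/ dir v a r /\ l <= d v r <= l.+2).
  case=> r0 /S1P[r0P r0l] st.
  have mv (Q : {set V}) : sector v Q (d v r0) r0 ->
      sector v Q (d v r) r /\ (d v r0).-1 <= d v r <= (d v r0).+1.
    by move=> Qr0; apply: sector_moved; [lia|exists r0].
  have [rP rl] := mv _ r0P; split=> //.
  case: r0l => -[dr0 dvr0]; [left|right].
    have [rP' _] := mv _ (sectorD1 r0P dr0); split; last by lia.
    by apply: dirN_sector rP'; rewrite !inE eqxx.
  have [rv|dr] := step_dir st dr0; first by move: rl; rewrite rv distxx; lia.
  by split=> //; lia.
(* The answer is at least [l.-1] outside [b] and at most [l.-1] behind it. Behind [a] it is at least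
   [l.+1], so equality rules out [a]. *)
apply: (@catch_probe b) => x _; have [lt|lt|eq_x] := ltngtP (d b x) l.-1.
- have := bP (d b x).+1; move/(@catch_leq _ n.+2) => cP.
  apply: catch_sub (cP _) => [r [/S1m[rP rl] dbr]|]; last by lia.
  by have [[dr dvr]|[ndr dbr']] := distb r; [split=> //; lia|case: rl => -[]; lia].
- have x1 : 0 < (d b x).-1 by lia.
  apply: catch_sub (nbP _ x1) => r [/S1m[rP rl] dbr].
  have [[dr dvr]|[ndr dbr']] := distb r; last first.
    by have <- : d v r = (d b x).-1 by [lia]; apply: sectorD1.
  case: rl => -[dar rl]; first by lia.
  by move: ab; rewrite (dir_uniq dar dr) eqxx.
(* If [l = 2], the robber may be at [v], from where the branch of [z] is open, so [slip_catch] takes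
   over with [a] and [b] exchanged. Otherwise he is off [v], and a probe at [v] recovers the
   distance. *)
have [l_eq2|l_ne2] := eqVneq l 2.
  have ba : b != a by rewrite eq_sym.
  have := @slip_catch n b a evb eva ba (fun l h => naP l (proj1 (andP h))) bP.
  by apply: catch_sub => r [_ ->]; rewrite eq_x l_eq2.
apply: (@catch_leq n.+1); first by [].
apply: (@center_probe n v (R :\ a)) => // r [/S1m[rP rl] dbr]; exists (d v r).
  by have [[dr dvr]|[ndr dbr']] := distb r; move/eqP: l_ne2; lia.
apply: sectorD1 => //.
have [[dr dvr]|[ndr dbr']] := distb r; last by case: rl => -[] //; lia.
by apply: contra ab => /dir_uniq/(_ dr) ->.
Qed.

End TwoBranchNeighbours.

(** * Branches with two leaves *)

Lemma branch_nleaves z v : e z v -> 2 < degree e v -> 1 < nleaves z v.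
Proof.
move=> ezv dv; rewrite nleaves_split //; last exact: ltnW.
have : 1 < #|nbrs v :\ z|.
  by move: dv; rewrite /degree -/(nbrs v) (cardsD1 z) inE edge_sym ezv.
move/leq_trans; apply; rewrite -sum1_card; apply: leq_sum => u.
by rewrite !inE => /andP[_ evu]; apply: nleaves_gt0.
Qed.

Lemma two_leaves v a : e v a -> 2 < degree e a -> nleaves v a = 2 ->
  exists a1 a2, [/\ e a a1 /\ a1 != v, e a a2 /\ a2 != v,
    nleaves a a1 = 1, nleaves a a2 = 1 & forall u, e a u -> [\/ u = v, u = a1 | u = a2]].
Proof.
move=> eva da; rewrite nleaves_split //; last exact: ltnW.
have /card_gt1P[a1 [a2 [a1N a2N a12]]] : 1 < #|nbrs a :\ v|.
  by move: da; rewrite /degree -/(nbrs a) (cardsD1 v) inE edge_sym eva.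
rewrite (bigD1 a1) //= (bigD1 a2) /=; last by rewrite a2N eq_sym.
move: (a1N) (a2N); rewrite !inE => /andP[a1v e1] /andP[a2v e2].
have P1 := nleaves_gt0 e1; have P2 := nleaves_gt0 e2 => sum2.
exists a1, a2; split=> // [||u eu]; [lia|lia|].
have [|uv] := eqVneq u v; first by constructor 1.
have [|u1] := eqVneq u a1; first by constructor 2.
have [|u2] := eqVneq u a2; first by constructor 3.
have : nleaves a a1 + nleaves a a2 + nleaves a u <= 2.
  rewrite -sum2 (bigD1 u) /=; last by rewrite !inE eu uv u1 u2.
  by rewrite !addnA leq_addr.
by rewrite leqNgt => /negP[]; apply: leq_add (leq_add P1 P2) (nleaves_gt0 eu).
Qed.

Section LightBranch.
Variables (v a a2 : V).
Hypotheses (eva : e v a) (ea2 : e a a2) (a2v : a2 != v) (P2 : nleaves a a2 = 1).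

(* The robber's possible positions when a probe at the leaf behind the other
   neighbour of [a] has confused the two cases. *)
Let rest (R : {set V}) l r :=
  sector v (R :\ a) l.-1 r \/ dir a a2 r /\ d v r = l.+1.

Let dist_leaf (b : V) : e a b -> nleaves a b = 1 -> exists x,
  [/\ forall r, ~~ dir a b r -> d x r = d a r + d x a,
      forall r, dir a b r -> d x r < d x a
    & forall r r', dir a b r -> dir a b r' -> d x r = d x r' -> r = r'].
Proof.
move=> eab Pb; have [x [dx xP xinj]] := path_branch eab Pb; exists x; split=> [r nd|r dr|r r' dr dr'].
- by rewrite dist_sym (dir_sep dx nd) (dist_sym r) (dist_sym a x).
- by have := xP r dr; have := dir_dist dr; lia.
by move=> xrr; apply: xinj => //; have := xP _ dr; have := xP _ dr'; lia.
Qed.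

(** Probe the end of the path behind [a2]. From distance [l.+1] the robber cannot have come back to
    [a], so on that path he is located; otherwise he is outside [a] at a known distance. *)
Lemma light_second n R l : 1 < l ->
  (forall l', 0 < l' <= l -> catch n (sector v (R :\ a) l')) -> catch n.+1 (rest R l).
Proof.
move=> l1 nP; have [x [out inn xinj]] := dist_leaf ea2 P2.
have mv r : moved (rest R l) r ->
    sector v (R :\ a) (d v r) r /\ d v r <= l \/ dir a a2 r.
  case=> r0 [r0P|[dr0 dvr0]] st; last first.
    right; have [ra|//] := step_dir st dr0.
    by have := step_dist v st; rewrite ra dvr0 (dist_edge eva); lia.
  left; have [||rP rl] := @sector_moved v (R :\ a) l.-1 r; first by lia.
    by exists r0.
  by split=> //; lia.
have outR r : sector v (R :\ a) (d v r) r -> d x r = (d v r).+1 + d x a.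
  move=> rP; have nda : ~~ dir v a r by apply: dirN_sector rP; rewrite !inE eqxx.
  rewrite out; first by rewrite (dirN_dist eva nda).
  by apply: contra nda; apply: dir_trans.
apply: (@catch_probe x) => y /mv[[yP yl]|dy]; last first.
  apply: catch_single => r r'.
  suff rE s : moved (rest R l) s /\ d x s = d x y -> s = y by move=> /rE-> /rE->.
  case=> /mv[[sP _] xs|ds xs]; last exact: xinj.
  by have := outR s sP; have := inn _ dy; lia.
apply: (@catch_sector _ v (R :\ a) (d v y)) => [y0|r [/mv[[rP _] xr|dr xr]]].
- by apply: nP; lia.
- by have <- : d v r = d v y by have := outR _ rP; have := outR _ yP; lia.
by have := inn _ dr; have := outR _ yP; lia.
Qed.

Variable a1 : V.
Hypotheses (ea1 : e a a1) (a1v : a1 != v) (P1 : nleaves a a1 = 1).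
Hypothesis aN : forall u, e a u -> [\/ u = v, u = a1 | u = a2].

(** Probing the end of the path behind [a1] locates a robber there and otherwise gives [d a r]. Only
    [d a r = l] fits both a position outside [a] and one behind [a2]; this is [rest]. *)
Lemma light_first n R l : 1 < l ->
  (forall l', 0 < l' -> catch n (sector v (R :\ a) l')) ->
  catch n (rest R l) -> catch n.+1 (sector v R l).
Proof.
move=> l1 nP restP; have l_gt0 : 0 < l by lia.
have [x [out inn xinj]] := dist_leaf ea1 P1.
apply: (@catch_probe x) => y _; have [dy|ndy] := boolP (dir a a1 y).
  apply: catch_single => r r'.
  suff rE s : moved (sector v R l) s /\ d x s = d x y -> s = y by move=> /rE-> /rE->.
  case=> _ xs; apply: xinj => //.
  by apply: contraT => /out; have := inn _ dy; lia.
have xE r : d x r = d x y -> ~~ dir a a1 r /\ d a r = d a y.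
  rewrite (out y ndy) => xr; have ndr : ~~ dir a a1 r by apply/negP => /inn; lia.
  by split=> //; move: xr; rewrite out //; lia.
have cases r : d x r = d x y ->
    [\/ r = a, ~~ dir v a r /\ d a y = (d v r).+1 | dir a a2 r /\ d v r = (d a y).+1].
  case/xE=> ndr <-; have [dr|nda] := boolP (dir v a r); last first.
    by constructor 2; rewrite (dirN_dist eva nda).
  have [ra|[u uv du]] := dir_split dr; first by constructor 1.
  constructor 3; rewrite (dir_dist dr); split=> //.
  case: (aN (dir_edge du)) => uE; subst u => //; first by rewrite eqxx in uv.
  by rewrite du in ndr.
have [y0|y0] := eqVneq (d a y) 0.
  by apply: catch_single => r r' [_ /xE[_]]; rewrite y0 => /dist_eq0<- [_ /xE[_]]; rewrite y0 => /dist_eq0.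
have na r : d x r = d x y -> r <> a.
  by move=> /xE[_ dar] ra; move: y0; rewrite -dar ra distxx.
have [lt|lt|eq_l] := ltngtP (d a y) l.
- apply: catch_single => r r'.
  suff rE s : moved (sector v R l) s /\ d x s = d x y -> dir a a2 s /\ d v s = (d a y).+1.
    move=> /rE[dr dvr] /rE[dr' dvr'].
    have [_ [_ _ inj2]] := path_branch ea2 P2.
    by apply: inj2 => //; move: dvr dvr'; rewrite !(dir_dist (dir_trans eva a2v _)) //; lia.
  case=> /(sector_moved l_gt0)[_ sl] xs.
  by have [/(na _ xs)|[_]|] := cases s xs; [by []|lia|].
- have y1 : 0 < (d a y).-1 by lia.
  apply: catch_sub (nP _ y1) => r [/(sector_moved l_gt0)[rP rl] xr].
  have [/(na _ xr)|[ndr dar]|[_]] := cases r xr; [by []| |lia].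
  by have <- : d v r = (d a y).-1 by [lia]; apply: sectorD1.
apply: catch_sub restP => r [/(sector_moved l_gt0)[rP rl] xr].
have [/(na _ xr)|[ndr dar]|[dr dvr]] := cases r xr; first by [].
  by left; have <- : d v r = l.-1 by [lia]; apply: sectorD1.
by right; split=> //; lia.
Qed.

End LightBranch.

Lemma light_distant n v (R : {set V}) a l : e v a -> 2 < degree e a -> nleaves v a = 2 ->
  1 < l -> (forall l', 0 < l' -> catch n (sector v (R :\ a) l')) ->
  catch n.+2 (sector v R l).
Proof.
move=> eva da Pa l1 nP.
have [a1 [a2 [[ea1 a1v] [ea2 a2v] P1 P2 aN]]] := two_leaves eva da Pa.
apply: (light_first eva ea2 a2v P2 ea1 a1v P1 aN l1) => [l' l'_gt0|].
  exact: catch_leq (nP l' l'_gt0).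
by apply: (light_second eva ea2 a2v P2 l1) => l' /andP[l'_gt0 _]; apply: nP.
Qed.

(* [star_catch] loses one probe to the confusion in [nonbranch_probe]; probing the
   two leaves behind [a] first avoids it when a single heavy [h] remains. *)
Lemma light_near v (R : {set V}) a l : {subset R <= nbrs v} -> a \in R ->
  2 < degree e a -> nleaves v a = 2 -> 0 < l <= 2 ->
  (forall h, h \in R -> h != a -> degree e h <= 2) ->
  (forall h, h \in R -> h != a -> forall l', catch (nleaves v h) (branch v h l')) ->
  (forall l', catch 1 (branch v a l')) ->
  catch (\sum_(h in R) nleaves v h - 1) (sector v R l).
Proof.
move=> RN aR da Pa /andP[l_gt0 l2] R2 Rc ac.
have eva : e v a by have := RN a aR; rewrite inE.
have [[h [hR ha Ph]]|light] :=
    pselect (exists h, [/\ h \in R, h != a & 1 < nleaves v h]); last first.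
  apply: (@star_catch v R a 1) => // [h hR ha Ph|l']; last by rewrite Pa.
  by case: light; exists h.
have evh : e v h by have := RN h hR; rewrite inE.
have aR' : a \in R :\ h by rewrite !inE eq_sym ha.
have sub x : x \in R :\ h -> x \in R by case/setD1P.
rewrite (big_setD1 h) //=; set s := \sum_(_ in _) _.
have s2 : 2 <= s by rewrite /s (big_setD1 a) //= Pa leq_addr.
have sc l' : 0 < l' -> catch s (sector v (R :\ h) l').
  move=> l'_gt0; rewrite -(subn0 s); apply: (@star_catch v (R :\ h) a 0) => //.
  - by move=> x /sub; apply: RN.
  - by move=> x /sub; apply: R2.
  - by move=> x _ _ _; rewrite Pa.
  - by move=> x /sub; apply: Rc.
  - by move=> l''; rewrite Pa; apply: catch_leq (ac l'').
(* The ambiguity in [nonbranch_probe] needs [l = 2], and [s] at least 3 pays for [catch_dir]; only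
   [l = s = 2] needs another strategy. *)
have [E|E] := boolP ((l == 2) && (s == 2)); last first.
  have -> : nleaves v h + s - 1 = (nleaves v h + s - 2).+1 by lia.
  apply: (@nonbranch_probe _ v R h) => // [|l' /andP[l'_gt0 _]|l' _|l_eq2].
  - exact: R2.
  - by apply: catch_leq (sc _ l'_gt0); lia.
  - by apply: catch_leq (Rc h hR ha l'); lia.
  apply: catch_leq (catch_dir (Rc h hR ha)).
  by move: E; rewrite l_eq2 eqxx /= => /eqP; lia.
case/andP: E => /eqP l_eq2 /eqP s_eq2; subst l; rewrite s_eq2.
(* Both leaves counted by [s] are behind [a], so [R] consists of [a] and [h]. *)
have Rah x : x \in R -> x != a -> x = h.
  move=> xR xa; apply/eqP; apply: contraT => xh.
  have exv : e v x by have := RN x xR; rewrite inE.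
  move: s_eq2; rewrite /s (big_setD1 a) //= Pa (big_setD1 x) ?inE ?xa ?xh //=.
  by have := nleaves_gt0 exv; lia.
have inh l' r : 0 < l' -> sector v (R :\ a) l' r -> branch v h l' r.
  move=> l'_gt0 [dr rR]; split=> //.
  have /dir_ex[u du] : v <> r by move=> vr; move: l'_gt0; rewrite -dr vr distxx.
  by have := rR u du; rewrite !inE => /andP[ua uR]; rewrite -(Rah u uR ua).
have -> : nleaves v h + 2 - 1 = (nleaves v h).+1 by lia.
have [a1 [a2 [[ea1 a1v] [ea2 a2v] P1 P2 aN]]] := two_leaves eva da Pa.
apply: (light_first eva ea2 a2v P2 ea1 a1v P1 aN (ltnSn 1)) => [l' l'_gt0|].
  by apply: catch_sub (Rc h hR ha l') => r; apply: inh.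
(* One probe is enough here: a robber not located behind [a2] is behind [h] within distance 2 of
   [v], where the distance determines the vertex. *)
apply: (@catch_leq 1); first exact: ltnW.
apply: (light_second eva ea2 a2v P2 (ltnSn 1)) => l' /andP[l'_gt0 l'2].
apply: catch_single => r r' /inh rP /inh r'P.
exact: near_branch_single (R2 h hR ha) l'2 (rP l'_gt0) (r'P l'_gt0).
Qed.

(** * Induction on the branches *)

Lemma two_branches_catch v z a b l : e v z -> a \in nbrs v :\ z -> b \in nbrs v :\ z ->
  a != b -> 2 < degree e a -> 2 < degree e b -> nleaves v a <= nleaves v b -> 0 < l ->
  (forall h l', h \in nbrs v :\ z ->
     catch (nleaves v h - (nleaves v h <= 3)) (branch v h l')) ->
  catch (\sum_(h in nbrs v :\ z) nleaves v h) (sector v (nbrs v :\ z) l).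
Proof.
move=> evz aR bR ab da db Pab l_gt0 cP; set R := nbrs v :\ z in aR bR cP *.
have RN : {subset R <= nbrs v} by move=> x /setD1P[].
have eR x : x \in R -> e v x by move/RN; rewrite inE.
have eva := eR a aR; have evb := eR b bR.
have cP' h l' : h \in R -> catch (nleaves v h) (branch v h l').
  by move=> hR; apply: catch_leq (cP h l' hR); lia.
have zN x : x \in R -> x != z by case/setD1P.
have dz : degree e z <= 2.
  by apply: (branch_nbrs eva evb evz) => //; apply: zN.
have dh h : h \in R -> h != a -> h != b -> degree e h <= 2.
  by move=> hR ha hb; apply: (branch_nbrs eva evb (eR h hR)) => //; rewrite eq_sym.
have Pa := branch_nleaves eva da; have Pb := branch_nleaves evb db.
have sub c x : x \in R :\ c -> x \in R by case/setD1P.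
have sumD1 c : c \in R ->
    \sum_(h in R) nleaves v h = nleaves v c + \sum_(h in R :\ c) nleaves v h.
  by move=> cR; rewrite (big_setD1 c).
have aRb : a \in R :\ b by apply/setD1P.
have bRa : b \in R :\ a by apply/setD1P; split=> //; rewrite eq_sym.
have qa dl l' : 0 < l' -> dl <= 1 -> dl.+2 <= nleaves v b ->
    (forall l'', catch (nleaves v b - dl) (branch v b l'')) ->
    catch (\sum_(h in R :\ a) nleaves v h - dl) (sector v (R :\ a) l').
  move=> l'_gt0 dl1 Pdl bc; apply: (@star_catch v (R :\ a) b) => //.
  - by move=> x /sub; apply: RN.
  - by move=> x /setD1P[xa xR] xb; apply: dh.
  - by move=> x /sub xR _ l''; apply: cP'.
have qb l' : 0 < l' -> catch (\sum_(h in R :\ b) nleaves v h) (sector v (R :\ b) l').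
  move=> l'_gt0; rewrite -[\sum_(h in _) _]subn0.
  apply: (@star_catch v (R :\ b) a) => //.
  - by move=> x /sub; apply: RN.
  - by move=> x /setD1P[xb xR] xa; apply: dh.
  - by move=> x /sub xR _ l''; apply: cP'.
  - by move=> l''; rewrite subn0; apply: cP'.
have Ea := sumD1 a aR; have Eb := sumD1 b bR.
have sa : nleaves v b <= \sum_(h in R :\ a) nleaves v h.
  by rewrite (big_setD1 b) //= leq_addr.
have sb : nleaves v a <= \sum_(h in R :\ b) nleaves v h.
  by rewrite (big_setD1 a) //= leq_addr.
move: qa qb Ea Eb sa sb; set P := \sum_(h in R) _.
set sa := \sum_(h in R :\ a) _; set sb := \sum_(h in R :\ b) _ => qa qb Ea Eb sa_ge sb_ge.
have qa0 l' : 0 < l' -> catch sa (sector v (R :\ a) l').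
  by move=> l'_gt0; rewrite -(subn0 sa); apply: qa => // l''; rewrite subn0; apply: cP'.
have [l_eq1|l_ne1] := eqVneq l 1.
  subst l; have -> : P = (P - 3).+3 by lia.
  apply: (@adjacent_catch v z evz dz _ a b) => // [l' l'_gt0|l' l'2|l'].
  - by apply: catch_leq (qa0 l' l'_gt0); lia.
  (* Three leaves behind [b] pay for the three probes. Otherwise [a] and [b] have two leaves each,
     and [light_near] saves the missing probe. *)
  - have [Pb3|Pb3] := leqP 3 (nleaves v b).
      by have /andP[l'_gt0 _] := l'2; apply: catch_leq (qb l' l'_gt0); lia.
    have Pa2 : nleaves v a = 2 by lia.
    have -> : P - 3 = sb - 1 by lia.
    apply: (@light_near v (R :\ b) a) => //.
    + by move=> x /sub; apply: RN.
    + by move=> x /setD1P[xb xR] xa; apply: dh.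
    + by move=> x /sub xR _ l''; apply: cP'.
    + by move=> l''; have := cP a l'' aR; rewrite Pa2.
  by apply: catch_leq (cP' a l' aR); lia.
have l1 : 1 < l by move/eqP: l_ne1; lia.
have [Pa2|Pa3] := leqP (nleaves v a) 2.
  have -> : P = sa.+2 by lia.
  by apply: light_distant qa0 => //; lia.
have -> : P = (P - 4).+4 by lia.
have ba : b != a by rewrite eq_sym.
(* The branch with more leaves is probed first, as its exclusion must pay for four probes. If it has
   only three leaves, so has the branch of [a], and the probe saved there covers the deficit. *)
apply: (@distant_catch v z evz dz _ b a) => // [l' l'_gt0|l' l'_gt0|l'|l'].
- have [Pb4|Pb3] := leqP 4 (nleaves v b).
    by apply: catch_leq (qb l' l'_gt0); lia.
  have -> : P - 4 = sb - 1 by lia.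
  apply: (@star_catch v (R :\ b) a) => //.
  + by move=> x /sub; apply: RN.
  + by move=> x /setD1P[xb xR] xa; apply: dh.
  + by move=> x /sub xR _ l''; apply: cP'.
  + move=> l''; have Pa_eq : nleaves v a = 3 by lia.
    by have := cP a l'' aR; rewrite Pa_eq.
- by apply: catch_leq (qa0 l' l'_gt0); lia.
- by apply: catch_leq (cP' b l' bR); lia.
- by apply: catch_leq (cP' a l' aR); lia.
Qed.

(** The saving starts at a branch consisting of one leaf, located by its distance alone, and is
    passed on by [star_catch]. [two_branches_catch] relies on it for branches with two or three
    leaves. *)
Lemma branch_catch z v l : e z v ->
  catch (nleaves z v - (nleaves z v <= 3)) (branch z v l).
Proof.
have [n] := ubnP #|[set x | dir z v x]|; elim: n z v l => // n IHn z v l lt ezv.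
have [dv|dv] := leqP (degree e v) 1.
  by apply: catch_single => r r' [/(dir_leaf dv)-> _] [/(dir_leaf dv)-> _].
have IH u l' : u \in nbrs v :\ z ->
    catch (nleaves v u - (nleaves v u <= 3)) (branch v u l').
  rewrite !inE => /andP[uz evu]; apply: IHn => //.
  exact: leq_trans (dir_card ezv uz evu) lt.
have IH' u l' : u \in nbrs v :\ z -> catch (nleaves v u) (branch v u l').
  by move=> uR; apply: catch_leq (IH u l' uR); lia.
rewrite nleaves_split //; set R := nbrs v :\ z in IH IH' *; set P := \sum_(_ in _) _.
have RN : {subset R <= nbrs v} by move=> x /setD1P[].
have eR x : x \in R -> e v x by move/RN; rewrite inE.
have evz : e v z by rewrite edge_sym.
suff sP l' : 0 < l' -> catch (P - (P <= 3)) (sector v R l').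
  apply: (@catch_sector _ v R l.-1); first exact: sP.
  move=> r [dr dzr]; have := dir_dist dr; rewrite dzr => ->; split=> // u du.
  rewrite !inE (dir_edge du) andbT; apply: contraTneq du => ->.
  by rewrite (dir_flip _ ezv) dr.
move=> l'_gt0.
have [[a [b [aR bR ab da db]]]|few] := pselect (exists a b,
    [/\ a \in R, b \in R, a != b, 2 < degree e a & 2 < degree e b]).
  have Pge : nleaves v a + nleaves v b <= P.
    rewrite /P (big_setD1 a) //= (big_setD1 b) /= ?addnA ?leq_addr //.
    by apply/setD1P; split=> //; rewrite eq_sym.
  have := branch_nleaves (eR a aR) da; have := branch_nleaves (eR b bR) db => Pb Pa.
  (* Behind each of [a] and [b] there are at least two leaves, so [P] is at least 4 and no saving is
     claimed. *)
  have -> : P - (P <= 3) = P by lia.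
  case: (leqP (nleaves v a) (nleaves v b)) => Pab; first exact: (@two_branches_catch v z a b).
  by apply: (@two_branches_catch v z b a) => //; rewrite 1?eq_sym // ltnW.
(* The branch left unprobed is that of a neighbour of degree at least 3 if there is one, else one
   with the most leaves. *)
have [u uR uP] : exists2 u, u \in R & forall h, h \in R -> h != u ->
    degree e h <= 2 /\ (1 < nleaves v h -> 1 < nleaves v u).
  have [[u [uR du]]|none] := pselect (exists u, u \in R /\ 2 < degree e u).
    exists u => // h hR hu; split=> [|_]; last by apply: branch_nleaves => //; apply: eR.
    by rewrite leqNgt; apply/negP => dh; apply: few; exists h, u.
  have [w wR] : exists w, w \in R.
    apply/set0Pn; rewrite -card_gt0; move: dv.
    by rewrite /degree -/(nbrs v) (cardsD1 z) inE evz.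
  have [u uR umax] := @arg_maxnP V w (mem R) (nleaves v) wR.
  exists u => // h hR _; split.
    by rewrite leqNgt; apply/negP => dh; apply: none; exists h.
  by move/leq_trans; apply; apply: umax.
have uP' : nleaves v u <= P by rewrite /P (big_setD1 u) //= leq_addr.
apply: (@star_catch v R u) => // [|h hR hu|h hR hu Ph|h hR _ l''|l''].
- by case: (P <= 3).
- by have [] := uP h hR hu.
- have [_ /(_ Ph) Pu] := uP h hR hu.
  (* Two branches with at least two leaves each make [P] at least 4, so the saving [dl] is 0
     here. *)
  have : nleaves v u + nleaves v h <= P.
    rewrite /P (big_setD1 u) //= (big_setD1 h) /= ?addnA ?leq_addr //.
    by apply/setD1P.
  by lia.
- exact: IH'.
by apply: catch_leq (IH u l'' uR); lia.
Qed.

Lemma tree_catch : catch (num_leaves e) (fun=> True).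
Proof.
have [single|] := pselect (forall x y : V, x = y).
  by apply: catch_single => x y _ _; apply: single.
move/existsNP=> [a /existsNP[b ab]].
have [c /dir_edge eac] := dir_ex ab.
have := nleaves_gt0 eac; rewrite card_gt0 => /set0Pn[x].
rewrite inE => /andP[lx _].
have /cards1P[v xN] := lx.
have exv : e x v by have := set11 v; rewrite -xN inE.
have xdir r : r != x -> dir x v r.
  rewrite eq_sym => /eqP/dir_ex[u du]; have := dir_edge du.
  by have := in_set1 u v; rewrite -xN inE => -> /eqP <-.
(* The first probe, at [x], is paid for by [x] itself, which is not counted in [nleaves x v]. *)
have -> : num_leaves e = (nleaves x v).+1.
  rewrite /num_leaves (cardsD1 x) inE [_ == 1]lx add1n; congr _.+1.
  apply: eq_card => r; rewrite !inE /leaf; have [->|rx] := eqVneq r x.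
    by rewrite dir_self andbF.
  by rewrite xdir // andbT.
apply: (@catch_probe x) => y _; have [<-|yx] := eqVneq y x.
  by apply: catch_single => r r' [_]; rewrite distxx => /dist_eq0 <- [_ /dist_eq0].
have := @branch_catch x v (d x y) exv; move/(@catch_leq _ (nleaves x v)) => cP.
apply: catch_sub (cP _) => [r [_ xr]|]; last by lia.
split=> //; apply: xdir; apply: contraNneq yx => rx.
by move: xr; rewrite rx distxx => /esym/dist_eq0 ->.
Qed.

End Tree.

Theorem theorem2p2 (V : finType) (e : rel V)
    (treeT : is_tree e) (noT33 : ~ has_subgraph e T33) :
  lcapt e <= num_leaves e.
Proof.
have [s win] := catch_wins treeT (tree_catch treeT noT33).
have winning : winning_strategy e s.
  by move=> r /win[n _ loc]; exists n.
have [_ conn _] := treeT; have [z_gt0 _ zmin] := localization_number_spec conn.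
have z1 : localization_number e = 1.
  by apply/eqP; rewrite eqn_leq z_gt0 andbT; apply: zmin winning.
rewrite /lcapt z1; have [|_ minm] := @lcaptk_spec V e 1; first by exists s.
exact: minm win.
Qed.
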